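(* For every $\epsilon>0$ there exists a positive integer $S_\epsilon$, with $S_\epsilon=O(\mathrm{polylog}(1/\epsilon))$, such that for every real $n>0$, every integer $\ell\ge 1$ and every $k\in\{0,1,\ldots,2^\ell-1\}$, the restriction of $\exp(-nD(p\|q))$ to the block $B_{\ell,k}$ has an $O(\epsilon)$-accurate $S_\epsilon$-term separated approximation. That is, there exist real-valued functions $\alpha_i(p)$ and $\beta_i(q)$, $1\le i\le S_\epsilon$ (which may depend on $\epsilon,n,\ell,k$), such that for all $(p,q)\in B_{\ell,k}$ $$\exp(-nD(p\|q))=\sum_{i=1}^{S_\epsilon}\alpha_i(p)\beta_i(q)+O(\epsilon).$$
   Context: $D$ is the Kullback-Leibler divergence of two Bernoulli distributions with parameters $p,q\in[0,1]$: $D(p\|q)=p\ln(p/q)+(1-p)\ln((1-p)/(1-q))$, with the usual conventions $0\ln(0/b)=0$ for $b\ge 0$ and $a\ln(a/0)=+\infty$ for $a>0$ (so $\exp(-nD(p\|q))=0$ when $D(p\|q)=+\infty$). For each integer $\ell\ge 1$ and $k\in\{0,1,\ldots,2^\ell-1\}$, the block $B_{\ell,k}\subset[0,1]^2$ (first coordinate $p$, second coordinate $q$) is $$B_{\ell,k}=\begin{cases}[k/2^\ell,(k+1)/2^\ell]\times[(k+1)/2^\ell,(k+2)/2^\ell], & k\text{ even},\\ [k/2^\ell,(k+1)/2^\ell]\times[(k-1)/2^\ell,k/2^\ell], & k\text{ odd}.\end{cases}$$ Asymptotic notation: $S_\epsilon=O(\mathrm{polylog}(1/\epsilon))$ means that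 there are absolute constants $A,m>0$ with $S_\epsilon\le A(\ln(1/\epsilon))^m$ for all $0<\epsilon\le 1/2$. The error term $O(\epsilon)$ denotes a quantity of absolute value at most $C\epsilon$, with $C$ an absolute constant independent of $\epsilon,n,\ell,k,p,q$. *)

(* Defs.v *)
From mathcomp Require Import all_boot all_order all_algebra.
From mathcomp Require Import all_classical all_reals all_analysis.
Set Implicit Arguments.
Unset Strict Implicit.
Unset Printing Implicit Defensive.
Import Order.TTheory GRing.Theory Num.Theory.
Import numFieldNormedType.Exports.

Local Open Scope classical_set_scope.
Local Open Scope ring_scope.

(* a ln (a / b) for a, b >= 0, with 0 ln (0 / b) = 0 (including b = 0) and
   a ln (a / 0) = +oo for a > 0. *)
Definition kl_term {R : realType} (a b : R) : \bar R :=
  if a == 0 then 0%E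
  else if b == 0 then +oo%E
  else (a * ln (a / b))%:E.

(* Kullback-Leibler divergence of Bernoulli(p) from Bernoulli(q); for p, q in
   [0, 1] no term is -oo, so the extended sum is never +oo - oo. *)
Definition kl_bernoulli {R : realType} (p q : R) : \bar R :=
  (kl_term p q + kl_term (1 - p) (1 - q))%E.

(* The truncated predecessor k.-1 is only used for k odd, hence k >= 1. *)
Definition block {R : realType} (l k : nat) : set (R * R) :=
  `[k%:R / 2 ^+ l, k.+1%:R / 2 ^+ l] `*`
  (if odd k then `[k.-1%:R / 2 ^+ l, k%:R / 2 ^+ l]%classic
   else `[k.+1%:R / 2 ^+ l, k.+2%:R / 2 ^+ l]%classic).

Definition has_separated_approx {R : realType}
    (f : R -> R -> \bar R) (B : set (R * R)) (s : nat) (delta : R) : Prop :=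
  exists alpha beta : 'I_s -> R -> R,
    forall p q : R, B (p, q) ->
      (`| f p q - (\sum_(i < s) alpha i p * beta i q)%R%:E | <= delta%:E)%E.

Definition polylog_inv_bounded {R : realType} (S : R -> nat) : Prop :=
  exists A m : R, [/\ 0 < A, 0 < m &
    forall eps : R, 0 < eps -> eps <= 1 / 2 ->
      (S eps)%:R <= A * (ln (1 / eps)) `^ m].

(* Main.v *)
(* Let a be the corner shared by the block and the diagonal, x = a - p and
   y = logit q - logit a.  The three-point identity reads
   D(p||q) = D(p||a) + D(a||q) + x y, where x y >= 0 on the block.  When
   n D(p||a) or n D(a||q) exceeds L = ln (1/eps) the kernel is at most eps and
   is replaced by 0.  Otherwise n x y <= 7 L: indeed
   0 <= D(2a - p||q) = D(2a - p||a) + D(a||q) - x y, and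
   D(2a - p||a) <= x^2 / (a (1 - a)) <= 6 D(p||a), the lower bound on D(p||a)
   coming from the Hellinger distance.  Hence O(L) terms of the Taylor series
   of exp(- n x y), which are separated, suffice. *)
Require Import Defs.
From mathcomp Require Import all_boot all_order all_algebra.
From mathcomp Require Import all_classical all_reals all_analysis.
From mathcomp Require Import ring lra.
Import Order.TTheory GRing.Theory Num.Theory.
Import numFieldNormedType.Exports.
Local Open Scope classical_set_scope.
Local Open Scope ring_scope.

(** * Tail of the exponential series *)

(** Since [B >= 1], each index [i >= J] has [B ^+ J <= B ^+ i], so [B ^+ J] times the tail is
    dominated by the full series at [B * |w|]. *)
Lemma expR_taylor_tail {R : realType} (B w : R) (J : nat) : 1 <= B ->
  `|expR w - \sum_(i < J) w ^+ i / i`!%:R| <= expR (B * `|w|) / B ^+ J.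
Proof.
move=> B1; have B0 : 0 < B by apply: lt_le_trans B1.
set T := \sum_(i < J) _.
have tail_cvg : `|series (exp_coeff w) N - T| @[N --> \oo] --> `|expR w - T|.
  apply: cvg_norm; apply: cvgB; last exact: cvg_cst.
  exact: is_cvg_series_exp_coeff.
rewrite -(cvg_lim _ tail_cvg)//.
apply: limr_le; first by apply/cvg_ex; exists `|expR w - T|.
exists J => // N /= JN.
have -> : series (exp_coeff w) N - T = \sum_(J <= i < N) w ^+ i / i`!%:R.
  rewrite /series/= /exp_coeff/= (big_cat_nat _ JN)//= /T.
  by rewrite big_mkord addrAC subrr add0r.
apply: le_trans (ler_norm_sum _ _ _) _.
rewrite ler_pdivlMr ?exprn_gt0// mulr_suml.
apply: (@le_trans _ _ (series (exp_coeff (B * `|w|)) N)); last first.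
  apply: nondecreasing_cvgn_le; last exact: is_cvg_series_exp_coeff.
  apply/nondecreasing_seqP => i; rewrite /series/= big_nat_recr//= lerDl.
  by apply: exp_coeff_ge0; rewrite mulr_ge0// ltW.
rewrite /series/= [leRHS](big_cat_nat _ JN)//=; apply: ler_wpDl.
  by apply: sumr_ge0 => i _; apply: exp_coeff_ge0; rewrite mulr_ge0// ltW.
apply: ler_sum_nat => i /andP[Ji _].
rewrite /exp_coeff/= normrM normfV normrX normr_nat exprMn mulrAC.
rewrite ler_wpM2r ?invr_ge0// mulrC ler_wpM2r ?exprn_ge0//.
exact: ler_weXn2l.
Qed.

(** * Bounds on one term p ln (p / q) *)

Lemma mul_ln_div {R : realType} {p q : R} : 0 <= p -> 0 < q ->
  p * ln (p / q) = p * ln p - p * ln q.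
Proof.
rewrite le_eqVlt => /predU1P[<-|p0] q0; first by rewrite !mul0r subr0.
by rewrite ln_div ?posrE// mulrBr.
Qed.

(** With s, t the square roots of p, q, the term is - 2 s^2 ln (t / s), and ln (t / s) <= t / s - 1
    gives 2 s^2 - 2 s t, which is the left side. *)
Lemma mul_ln_div_ge {R : realType} {p q : R} : 0 <= p -> 0 < q ->
  p - q + (Num.sqrt p - Num.sqrt q) ^+ 2 <= p * ln (p / q).
Proof.
rewrite le_eqVlt => /predU1P[<-|p0] q0.
  by rewrite sqrtr0 !mul0r !sub0r sqrrN (sqr_sqrtr (ltW q0)) addNr.
have s0 : 0 < Num.sqrt p by rewrite sqrtr_gt0.
have t0 : 0 < Num.sqrt q by rewrite sqrtr_gt0.
rewrite -{1 3 4}(sqr_sqrtr (ltW p0)) -{1 3}(sqr_sqrtr (ltW q0)).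
move: (Num.sqrt p) (Num.sqrt q) s0 t0 => s t s0 t0.
rewrite -expr_div_n lnXn ?divr_gt0// -invf_div lnV ?posrE ?divr_gt0//.
have : ln (t / s) <= t / s - 1.
  by rewrite -{1}(subrKC 1 (t / s)) le_ln1Dx// ltrBDl subrr divr_gt0.
rewrite lerBrDr -(ler_pM2l (exprn_gt0 2 s0)) mulrDr mulr1.
have -> : s ^+ 2 * (t / s) = s * t by field; rewrite gt_eqF.
move: (ln _) => u; rewrite mulr2n; lra.
Qed.

Lemma mul_ln_div_ge_sqr {R : realType} {p q : R} : 0 <= p -> 0 < q ->
  p <= 2 * q ->
  p - q + (p - q) ^+ 2 / (6 * q) <= p * ln (p / q).
Proof.
move=> p0 q0 pq; apply: le_trans (mul_ln_div_ge p0 q0).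
rewrite lerD2l ler_pdivrMr ?mulr_gt0//.
rewrite -{1}(sqr_sqrtr p0) -{1 3}(sqr_sqrtr (ltW q0)).
move: pq; rewrite -{1}(sqr_sqrtr p0) -{1}(sqr_sqrtr (ltW q0)).
have := sqrtr_ge0 p; have := sqrtr_ge0 q.
move: (Num.sqrt p) (Num.sqrt q) => s t t0 s0 st.
have -> : (s ^+ 2 - t ^+ 2) ^+ 2 = (s - t) ^+ 2 * (s + t) ^+ 2 by ring.
(* The 6 comes from here: s^2 <= 2 t^2 gives (s + t)^2 <= (1 + sqrt 2)^2 t^2 < 6 t^2 for t > 0. *)
rewrite ler_wpM2l ?sqr_ge0//; nra.
Qed.

Lemma mul_ln_div_le {R : realType} {p q : R} : 0 <= p -> 0 < q ->
  p * ln (p / q) <= p - q + (p - q) ^+ 2 / q.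
Proof.
rewrite le_eqVlt => /predU1P[<-|p0] q0.
  by rewrite mul0r !sub0r sqrrN expr2 mulfK ?addNr// gt_eqF.
have : ln (p / q) <= p / q - 1.
  by rewrite -{1}(subrKC 1 (p / q)) le_ln1Dx// ltrBDl subrr divr_gt0.
rewrite -(ler_pM2l p0) => /le_trans; apply; rewrite le_eqVlt; apply/orP; left.
by apply/eqP; field; rewrite gt_eqF.
Qed.

(** * Real-valued divergence and the cross term *)

Definition kl {R : realType} (p q : R) : R :=
  p * ln (p / q) + (1 - p) * ln ((1 - p) / (1 - q)).

Definition logit {R : realType} (q : R) : R := ln q - ln (1 - q).

Lemma kl_bernoulliE {R : realType} {p q : R} : 0 < q < 1 ->
  kl_bernoulli p q = (kl p q)%:E.
Proof.
move=> /andP[q0 q1]; have termE (a b : R) : 0 < b ->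
    kl_term a b = (a * ln (a / b))%:E.
  by move=> b0; rewrite /kl_term (gt_eqF b0); case: eqP => // ->; rewrite !mul0r.
by rewrite /kl_bernoulli !termE// subr_gt0.
Qed.

Lemma kl_bernoulli_pinfty {R : realType} {p q : R} :
  (q = 0 /\ 0 < p) \/ (q = 1 /\ p < 1) -> kl_bernoulli p q = +oo%E.
Proof.
rewrite /kl_bernoulli /kl_term => -[[-> p0]|[-> p1]].
  rewrite (gt_eqF p0) eqxx addye//; case: ifP => // _; case: ifP => //.
rewrite subrr eqxx subr_eq0 (gt_eqF p1) addey//; case: ifP => // _.
by case: ifP.
Qed.

Lemma kl_ge0 {R : realType} {p q : R} : 0 <= p <= 1 -> 0 < q < 1 -> 0 <= kl p q.
Proof.
move=> /andP[p0 p1] /andP[q0 q1].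
have p1' : 0 <= 1 - p by rewrite subr_ge0.
have q1' : 0 < 1 - q by rewrite subr_gt0.
have := mul_ln_div_ge p0 q0; have := mul_ln_div_ge p1' q1'.
have := sqr_ge0 (Num.sqrt p - Num.sqrt q).
have := sqr_ge0 (Num.sqrt (1 - p) - Num.sqrt (1 - q)).
rewrite /kl; lra.
Qed.

Lemma kl_three_point {R : realType} {p a q : R} :
  0 <= p <= 1 -> 0 < a < 1 -> 0 < q < 1 ->
  kl p q = kl p a + kl a q + (a - p) * (logit q - logit a).
Proof.
move=> /andP[p0 p1] /andP[a0 a1] /andP[q0 q1].
rewrite /kl /logit !mul_ln_div ?subr_ge0 ?subr_gt0 ?(ltW a0) ?(ltW a1)//;
ring.
Qed.

(** Reflection in a preserves (p - a)^2, so the quadratic upper bound at 2a - p is 6 times the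
    quadratic lower bound at p; the linear terms of the two outcomes cancel. *)
Lemma kl_reflect_le {R : realType} {p a : R} :
  0 <= p <= 1 -> 0 < a < 1 -> 0 <= 2 * a - p <= 1 ->
  kl (2 * a - p) a <= 6 * kl p a.
Proof.
move=> /andP[p0 p1] /andP[a0 a1] /andP[r0 r1].
have p1' : 0 <= 1 - p by rewrite subr_ge0.
have a1' : 0 < 1 - a by rewrite subr_gt0.
have r1' : 0 <= 1 - (2 * a - p) by rewrite subr_ge0.
(* That 2a - p lies in [0, 1] is exactly what the lower bound requires for both outcomes. *)
have pa : p <= 2 * a by rewrite -subr_ge0.
have pa' : 1 - p <= 2 * (1 - a) by lra.
have := mul_ln_div_ge_sqr p0 a0 pa; have := mul_ln_div_ge_sqr p1' a1' pa'.
have := mul_ln_div_le r0 a0; have := mul_ln_div_le r1' a1'.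
rewrite !invfM !(mulrCA _ 6^-1).
have -> : 2 * a - p - a = a - p by ring.
have -> : 1 - (2 * a - p) - (1 - a) = p - a by ring.
have -> : 1 - p - (1 - a) = a - p by ring.
rewrite (_ : (a - p) ^+ 2 = (p - a) ^+ 2); last by ring.
rewrite /kl; lra.
Qed.

Lemma logit_cross_ge0 {R : realType} {p a q : R} :
  0 < a < 1 -> 0 < q < 1 -> 0 <= (a - p) * (q - a) ->
  0 <= (a - p) * (logit q - logit a).
Proof.
move=> /andP[a0 a1] /andP[q0 q1].
have logit_le (x y : R) : 0 < x -> y < 1 -> x <= y -> logit x <= logit y.
  move=> x0 y1 xy; have y0 := lt_le_trans x0 xy; have x1 := le_lt_trans xy y1.
  by rewrite /logit lerB// ler_ln ?posrE ?subr_gt0// lerB.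
have [aq|qa|->] := ltgtP a q; last by rewrite !subrr.
- rewrite pmulr_lge0 ?subr_gt0// => ap.
  by rewrite mulr_ge0// subr_ge0 logit_le// ltW.
- rewrite nmulr_lge0 ?subr_lt0// => ap.
  by rewrite mulr_le0// subr_le0 logit_le// ltW.
Qed.

(* Gibbs' inequality D(2a - p || q) >= 0 at the reflected point bounds the
   cross term of the three-point identity at p from above. *)
Lemma logit_cross_le {R : realType} {p a q : R} :
  0 <= p <= 1 -> 0 < a < 1 -> 0 < q < 1 -> 0 <= 2 * a - p <= 1 ->
  (a - p) * (logit q - logit a) <= 6 * kl p a + kl a q.
Proof.
move=> p01 a01 q01 r01; have := kl_ge0 r01 q01.
rewrite (kl_three_point r01 a01 q01) (_ : a - (2 * a - p) = - (a - p));
  last by ring.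
rewrite mulNr; have := kl_reflect_le p01 a01 r01; lra.
Qed.

(** * Separated approximation around a corner a *)

Lemma expR_kl_approx {R : realType} (n L : R) (J : nat) {p a q : R} : 0 < n ->
  (7 * expR 1 + 1) * L <= J%:R ->
  0 <= p <= 1 -> 0 < a < 1 -> 0 < q < 1 -> 0 <= 2 * a - p <= 1 ->
  0 <= (a - p) * (q - a) -> n * kl p a <= L -> n * kl a q <= L ->
  `|expR (- (n * kl p q)) -
    \sum_(i < J) (expR (- (n * kl p a)) * (- (n * (a - p))) ^+ i / i`!%:R) *
                 (expR (- (n * kl a q)) * (logit q - logit a) ^+ i)|
  <= expR (- L).
Proof.
move=> n0 JL p01 a01 q01 r01 pq nD1 nD2.
have w0 := logit_cross_ge0 a01 q01 pq.
have wL := logit_cross_le p01 a01 q01 r01.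
have p_ge0 := kl_ge0 p01 a01.
have a01' : 0 <= a <= 1 by case/andP: a01 => a0 a1; rewrite !ltW.
have q_ge0 := kl_ge0 a01' q01.
set x := a - p in w0 wL *; set y := logit q - logit a in w0 wL *.
pose w := - (n * (x * y)).
have -> : expR (- (n * kl p q)) =
    expR (- (n * kl p a)) * expR (- (n * kl a q)) * expR w.
  by rewrite (kl_three_point p01 a01 q01) -/x -/y -!expRD /w; congr expR; ring.
have -> : \sum_(i < J) (expR (- (n * kl p a)) * (- (n * x)) ^+ i / i`!%:R) *
                 (expR (- (n * kl a q)) * y ^+ i) =
    expR (- (n * kl p a)) * expR (- (n * kl a q)) *
    \sum_(i < J) w ^+ i / i`!%:R.
  rewrite mulr_sumr; apply: eq_bigr => i _.
  have -> : w = - (n * x) * y by rewrite /w; ring.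
  by rewrite exprMn; ring.
rewrite -mulrBr normrM ger0_norm ?mulr_ge0 ?expR_ge0//; clearbody x y.
rewrite -[leRHS]mul1r ler_pM ?mulr_ge0 ?expR_ge0//.
  rewrite -expRD expR_le1; have := mulr_ge0 (ltW n0) p_ge0.
  by have := mulr_ge0 (ltW n0) q_ge0; lra.
(* With base e the tail is at most exp (e |w| - J); since |w| <= 7 L, [J >= (7 e + 1) L] makes this
   at most exp (- L). *)
apply: le_trans (expR_taylor_tail (expR 1) w J _) _.
  by rewrite -[leLHS]expR0 ler_expR.
rewrite -expRM_natl mulr1 -expRB ler_expR /w normrN.
rewrite (ger0_norm (mulr_ge0 (ltW n0) w0)).
have : n * (x * y) <= 7 * L.
  by move: wL; rewrite -(ler_pM2l n0) mulrDr (mulrCA n 6); lra.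
rewrite -(ler_pM2l (expR_gt0 1)); lra.
Qed.

Lemma kl_separated_approx {R : realType} (n eps a : R) (J : nat)
    (B : set (R * R)) :
  0 < n -> 0 < eps -> 0 < a < 1 ->
  (7 * expR 1 + 1) * ln (1 / eps) <= J%:R ->
  (forall p q, B (p, q) -> [/\ 0 <= p <= 1, 0 <= q <= 1, 0 <= 2 * a - p <= 1 &
    0 <= (a - p) * (q - a)]) ->
  has_separated_approx (fun p q : R => expeR (- (n%:E * kl_bernoulli p q)))
    B J eps.
Proof.
move=> n0 eps0 a01 JL BP; set L := ln (1 / eps).
have epsL : eps = expR (- L).
  by rewrite /L div1r lnV ?posrE// opprK lnK ?posrE.
have [a0 a1] := andP a01.
(* Each cutoff tests one variable only, so the sum stays separated; the test [0 < q < 1] sets it to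
   0 where the divergence is infinite. *)
exists (fun i p => if n * kl p a <= L then
    expR (- (n * kl p a)) * (- (n * (a - p))) ^+ i / i`!%:R else 0).
exists (fun i q => if (0 < q < 1) && (n * kl a q <= L) then
    expR (- (n * kl a q)) * (logit q - logit a) ^+ i else 0).
move=> p q /BP[p01 /andP[q0 q1] r01 pq].
have [q01 | qN] := boolP (0 < q < 1); last first.
  rewrite big1 => [|i _]; last by rewrite mulr0.
  rewrite sube0 kl_bernoulli_pinfty ?gt0_muley ?lte_fin//=.
    by rewrite normr0 lee_fin ltW.
  (* The sign condition forces p >= a > 0 at q = 0 and p <= a < 1 at q = 1, so the divergence is
     infinite there. *)
  move: qN pq; rewrite negb_and -!leNgt => /orP[q0'|q1'].
    have -> : q = 0 by apply/eqP; rewrite eq_le q0' q0.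
    rewrite sub0r mulrN oppr_ge0 pmulr_lle0// subr_le0 => ap.
    by left; split => //; apply: lt_le_trans ap.
  have -> : q = 1 by apply/eqP; rewrite eq_le q1' q1.
  rewrite pmulr_lge0 ?subr_gt0// subr_ge0 => pa.
  by right; split => //; apply: le_lt_trans a1.
rewrite kl_bernoulliE// -EFinM -EFinN /= lee_fin epsL.
have [nD1 | nD1] := leP (n * kl p a) L; have [nD2 | nD2] := leP (n * kl a q) L.
- exact: expR_kl_approx.
all: rewrite big1 => [|i _]; last by rewrite ?mulr0 ?mul0r.
all: rewrite subr0 ger0_norm ?expR_ge0// ler_expR lerN2.
(* All three summands are nonnegative and one exceeds L after scaling by n. *)
all: rewrite (kl_three_point p01 a01 q01).
all: have := mulr_ge0 (ltW n0) (logit_cross_ge0 a01 q01 pq).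
all: have := mulr_ge0 (ltW n0) (kl_ge0 p01 a01).
all: have a01' : 0 <= a <= 1 by rewrite !ltW.
all: have := mulr_ge0 (ltW n0) (kl_ge0 a01' q01).
all: by move: nD1 nD2; clearbody L; lra.
Qed.

(** * Geometry of the blocks and choice of the number of terms *)

(** Reflection in the diagonal corner a swaps the p-interval and the q-interval, which lie on
    opposite sides of a within [0, 1]. *)
Lemma block_corner {R : realType} (l k : nat) : (1 <= l)%N -> (k < 2 ^ l)%N ->
  exists2 a : R, 0 < a < 1 & forall p q, block l k (p, q) ->
    [/\ 0 <= p <= 1, 0 <= q <= 1, 0 <= 2 * a - p <= 1 & 0 <= (a - p) * (q - a)].
Proof.
move=> l1 kl.
have grid j : (j.+2 <= 2 ^ l)%N -> exists c h : R,
    [/\ 0 <= c, 0 < h, c + 2 * h <= 1, j%:R / 2 ^+ l = c &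
        j.+1%:R / 2 ^+ l = c + h /\ j.+2%:R / 2 ^+ l = c + 2 * h].
  move=> jl; have N0 : 0 < 2 ^+ l :> R by rewrite exprn_gt0.
  have jSS : j.+2%:R / 2 ^+ l = j%:R / 2 ^+ l + 2 * (2 ^+ l)^-1 :> R.
    by rewrite -natr1 -natr1; ring.
  exists (j%:R / 2 ^+ l), (2 ^+ l)^-1.
  split; rewrite ?divr_ge0 ?invr_gt0 ?(ltW N0)//.
  - by rewrite -jSS ler_pdivrMr// mul1r -natrX ler_nat.
  - by split => //; rewrite -natr1 mulrDl mul1r.
rewrite /block; have [ko|ke] := boolP (odd k).
  case: k kl ko => // k kl _.
  have [c [h [c0 h0 ch1 -> [-> ->]]]] := grid k kl.
  exists (c + h); first by lra.
  move=> p q [/=]; rewrite !in_itv/= => /andP[? ?] /andP[? ?].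
  by split; [lra|lra|lra|apply: mulr_le0; lra].
(* For [l >= 1] the number [2 ^ l] is even, so an even k cannot be [2 ^ l - 1]. *)
have kl2 : (k.+2 <= 2 ^ l)%N.
  rewrite ltn_neqAle kl andbT; apply: contraNneq ke => kE.
  by have := congr1 odd kE; rewrite oddX orbF /= (gtn_eqF l1) => /negbFE.
have [c [h [c0 h0 ch1 -> [-> ->]]]] := grid k kl2.
exists (c + h); first by lra.
move=> p q [/=]; rewrite !in_itv/= => /andP[? ?] /andP[? ?].
by split; [lra|lra|lra|apply: mulr_ge0; lra].
Qed.

Theorem theorem4 (R : realType) :
  exists (C : R) (S : R -> nat),
    [/\ 0 < C,
        polylog_inv_bounded S,
        (forall eps : R, 0 < eps -> (0 < S eps)%N) &
        forall (eps n : R) (l k : nat),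
          0 < eps -> 0 < n -> (1 <= l)%N -> (k < 2 ^ l)%N ->
          has_separated_approx
            (fun p q : R => expeR (- (n%:E * kl_bernoulli p q)))
            (block l k) (S eps) (C * eps)].
Proof.
pose K : R := 7 * expR 1 + 1.
have K0 : 0 < K by rewrite ltr_wpDl// mulr_ge0// expR_ge0.
(* The successor rounds up and keeps the count positive even when [eps >= 1] makes the logarithm
   nonpositive. *)
exists 1, (fun eps => (Num.truncn (K * ln (1 / eps))).+1); split => //.
- have ln2 : 0 < ln 2 :> R by rewrite ln_gt0// ltr1n.
  (* The summand [1 / ln 2] absorbs the successor, as [ln (1 / eps) >= ln 2]. *)
  exists (K + 1 / ln 2), 1; split => //; first by rewrite addr_gt0// divr_gt0.
  move=> eps eps0 eps2.
  have L2 : ln 2 <= ln (1 / eps).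
    by rewrite ler_ln ?posrE ?divr_gt0// ler_pdivlMr//; lra.
  have L0 : 0 < ln (1 / eps) by apply: lt_le_trans L2.
  rewrite powRr1 ?(ltW L0)// -natr1 [leRHS]mulrDl lerD//.
    by rewrite truncn_le mulr_ge0// ltW.
  by rewrite mulrC mulrA mulr1 ler_pdivlMr// [leLHS]mul1r.
- move=> eps n l k eps0 n0 l1 kl; rewrite (mul1r eps).
  have [a a01 aP] := @block_corner R l k l1 kl.
  by apply: (@kl_separated_approx _ n eps a) => //; exact/ltW/truncnS_gt.
Qed.
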